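(* Let $\widehat{\mathcal B}_n$ be the compressed random binary search tree and let $t$ be a full binary tree. Then, as $n\to\infty$, $$q(\widehat{\mathcal B}_n;t\mid\widehat{\mathcal B}_n)\overset{\mathrm p}{\longrightarrow}q(\widehat{\mathcal B}^{**}_\infty;t)=3|t|_{\mathsf e}\hat\beta_t,$$ $$q(\widehat{\mathcal B}_n;t)\longrightarrow q(\widehat{\mathcal B}^{**}_\infty;t).$$
   Context: Trees. A binary tree is a (finite, non-empty) rooted tree in which each child is labelled left or right and each node has at most one left and at most one right child. It is full if each node has outdegree 0 or 2. $|T|_{\mathsf e}$ is the number of leaves of $T$. For $v\in T$, the fringe tree $T^v$ consists of $v$ and all its descendants, and $N_t(T):=|\{v\in T:T^v=t\}|$ (equality as binary trees). For a (random) tree $T$ and a fixed tree $t$, $q(T;t)$ is the probability that a uniformly random leaf of $T$ lies in some fringe tree $T^w$ isomorphic to $t$, and $q(T;t\mid T)$ is the corresponding conditional probability given $T$. $q(\widehat{\mathcal B}^{**}_\infty;t)$ denotes the limit $\lim_{n\to\infty}q(\widehat{\mathcal B}_n;t)$. The compression $\widehat T$ of a binary tree $T$ is the full binary tree obtained by deleting all nodes of outdegree 1 and connecting the remaining nodes in the obvious way. Binary search tree. The random binary search tree $\mathcal B_n$ is defined recursively from $n$ distinct real numbers: $\mathcal B_0$ is empty, $\mathcal B_1$ is a single node, and for $n\ge2$ a uniformly random one of the numbers (the pivot) is chosen at the root, and the left and right subtrees of the root are constructed recursively, independently, from the set of numbers smaller, respectively larger, than the pivot. $\widehat{\mathcal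 B}_n$ is the compression of $\mathcal B_n$. $\hat\beta_t>0$ is the (existing) constant such that, as $n\to\infty$, $(N_t(\widehat{\mathcal B}_n)-n\hat\beta_t)/\sqrt n$ converges in distribution to a centred normal distribution; in particular $\hat\beta_t$ is the limit in probability of $N_t(\widehat{\mathcal B}_n)/n$. *)

(* Defs.v *)
From HB Require Import structures.
From mathcomp Require Import all_boot all_order all_algebra.
From mathcomp Require Import all_classical all_reals all_analysis.
Set Implicit Arguments.
Unset Strict Implicit.
Unset Printing Implicit Defensive.
Import Order.TTheory GRing.Theory Num.Theory.
Import numFieldNormedType.Exports.
Local Open Scope classical_set_scope.
Local Open Scope ring_scope.

(* [BEmpty] is the empty tree (an absent child, or the search tree on no
   numbers); the binary trees in the usual, non-empty, sense are the others.
   Leibniz equality on [btree] is equality as binary trees, which is also the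
   meaning of "isomorphic" for binary trees below. *)
Inductive btree := BEmpty | BNode of btree & btree.

Fixpoint btree_encode (T : btree) : GenTree.tree unit :=
  if T is BNode l r then GenTree.Node 0 [:: btree_encode l; btree_encode r]
  else GenTree.Leaf tt.

Fixpoint btree_decode (g : GenTree.tree unit) : btree :=
  if g is GenTree.Node _ [:: l; r] then BNode (btree_decode l) (btree_decode r)
  else BEmpty.

Lemma btree_encodeK : cancel btree_encode btree_decode.
Proof. by elim=> //= l -> r ->. Qed.

HB.instance Definition _ := Countable.copy btree (can_type btree_encodeK).
HB.instance Definition _ := isPointed.Build btree BEmpty.
HB.instance Definition _ := @isMeasurable.Build default_measure_display
  btree discrete_measurable discrete_measurable0
  discrete_measurableC discrete_measurableU.

(* A node is the list of the left ([false]) / right ([true]) steps leading to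
   it from the root, so that w is an ancestor of v (or v itself) iff the list w
   is a prefix of v. *)
Fixpoint nodes (T : btree) : seq (seq bool) :=
  if T is BNode l r then
    [::] :: [seq false :: v | v <- nodes l] ++ [seq true :: v | v <- nodes r]
  else [::].

Fixpoint fringe (T : btree) (v : seq bool) : btree :=
  if v is b :: v' then
    if T is BNode l r then fringe (if b then r else l) v' else BEmpty
  else T.

Definition root_outdegree (T : btree) : nat :=
  if T is BNode l r then ((l != BEmpty) + (r != BEmpty))%N else 0%N.

Definition outdegree (T : btree) (v : seq bool) : nat :=
  root_outdegree (fringe T v).

Definition leaves (T : btree) : seq (seq bool) :=
  [seq v <- nodes T | outdegree T v == 0%N].

(* |T|_e *)
Definition nleaves (T : btree) : nat := size (leaves T).

Definition full (T : btree) : bool :=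
  (T != BEmpty) &&
  all (fun v => (outdegree T v == 0%N) || (outdegree T v == 2%N)) (nodes T).

(* N_t(T) *)
Definition nfringe (t T : btree) : nat :=
  count (fun v => fringe T v == t) (nodes T).

(* The node v of T lies in a fringe tree T^w equal to t. *)
Definition in_copy (t T : btree) (v : seq bool) : bool :=
  has (fun w => (fringe T w == t) && prefix w v) (nodes T).

(* q(T; t | T): a uniformly random leaf of the given tree T. *)
Definition q_given (R : realType) (t T : btree) : R :=
  (count (in_copy t T) (leaves T))%:R / (nleaves T)%:R.

Fixpoint compress (T : btree) : btree :=
  match T with
  | BEmpty => BEmpty
  | BNode BEmpty BEmpty => BNode BEmpty BEmpty
  | BNode BEmpty r => compress r
  | BNode l BEmpty => compress l
  | BNode l r => BNode (compress l) (compress r)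
  end.

(* The probability that the random binary search tree built from the distinct
   numbers s is T: the pivot x is uniform in s and, given x, the two subtrees
   are independent random binary search trees on the numbers smaller, resp.
   larger, than x. *)
Fixpoint bst_prob (R : realType) (T : btree) (s : seq R) : R :=
  if T is BNode l r then
    (size s)%:R^-1 *
    \sum_(x <- s) bst_prob l [seq y <- s | y < x] *
                  bst_prob r [seq y <- s | x < y]
  else (s == [::])%:R.

Definition is_random_bst (R : realType) (s : seq R)
    (d : measure_display) (Om : measurableType d) (P : probability Om R)
    (B : {RV P >-> btree}) : Prop :=
  forall T : btree, distribution P B [set T] = (bst_prob T s)%:E.

(* q(T; t) for the random tree T: the probability, averaged over T as well, that
   a uniformly random leaf of T lies in a copy of t. *)
Definition q_random (R : realType) (t : btree)
    (d : measure_display) (Om : measurableType d) (P : probability Om R)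
    (T : Om -> btree) : R :=
  fine 'E_P[fun w => q_given R t (T w)].

(* In the two modes of convergence to a constant, resp. to a law mu, the n-th
   variable may live on its own probability space. *)
Definition cvg_in_probability (R : realType) (d : nat -> measure_display)
    (Om : forall n, measurableType (d n)) (P : forall n, probability (Om n) R)
    (X : forall n, Om n -> R) (c : R) : Prop :=
  forall e : R, 0 < e ->
    (fun n => P n [set w | e <= `|X n w - c|]) @ \oo --> 0%E.

Definition cvg_in_distribution (R : realType) (d : nat -> measure_display)
    (Om : forall n, measurableType (d n)) (P : forall n, probability (Om n) R)
    (X : forall n, Om n -> R) (mu : set R -> \bar R) : Prop :=
  forall x : R, {for x, continuous (fun y : R => mu `]-oo, y]%classic)} ->
    (fun n => P n [set w | X n w <= x]) @ \oo --> mu `]-oo, x]%classic.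

(* N(0, sigma^2); the library's [normal_prob 0 0] is by convention a uniform
   law, whereas the normal law of variance 0 is the point mass at 0. *)
Definition centred_normal (R : realType) (sigma : R) : set R -> \bar R :=
  if sigma == 0 then \d_(0 : R) else normal_prob 0 sigma.

(* beta is the constant \hat\beta_t of the central limit theorem for the number
   of fringe trees t in the compressed random binary search trees. *)
Definition is_beta_hat (R : realType) (d : nat -> measure_display)
    (Om : forall n, measurableType (d n)) (P : forall n, probability (Om n) R)
    (B : forall n, {RV P n >-> btree}) (t : btree) (beta : R) : Prop :=
  0 < beta /\
  exists2 sigma : R, 0 <= sigma &
    cvg_in_distribution P
      (fun n w => ((nfringe t (compress (B n w)))%:R - n%:R * beta)
                  / Num.sqrt n%:R)
      (centred_normal sigma).

(* Main.v *)
(* Distinct fringe copies of t are disjoint, so q(T; t | T) is |t|_e N_t(T) / |T|_e,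
   and compression preserves |T|_e. By the central limit theorem assumed for
   N_t, N_t / n tends to beta in probability. The number of leaves L of the
   uncompressed tree on n numbers is additive over the two subtrees of the
   root unless both are empty; hence so is its deviation D = L - (n + 1) / 3, which therefore has
   mean 0 for n >= 2 and second moment at most n + 1 (by induction on n), and
   L / n tends to 1 / 3 by Chebyshev's inequality. The quotient
   tends to 3 |t|_e beta in probability, and in mean since it lies in [0, 1]. *)
Require Import Defs.
From mathcomp Require Import all_boot all_order all_algebra.
From mathcomp Require Import all_classical all_reals all_analysis.
From mathcomp Require Import measurable_realfun zify ring lra.
Set Implicit Arguments.
Unset Strict Implicit.
Unset Printing Implicit Defensive.
Import Order.TTheory GRing.Theory Num.Theory.
Import numFieldNormedType.Exports.
Local Open Scope classical_set_scope.
Local Open Scope ring_scope.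

(** * Leaves and fringe copies *)

Lemma nleaves_node (l r : btree) :
  nleaves (BNode l r) =
  (if (l == BEmpty) && (r == BEmpty) then 1 else nleaves l + nleaves r)%N.
Proof.
rewrite /nleaves /leaves /= filter_cat !filter_map.
by case: l r => [|? ?] [|? ?] /=; rewrite ?size_cat ?size_map ?addn0.
Qed.

Lemma compress_eq_empty (T : btree) : (compress T == BEmpty) = (T == BEmpty).
Proof. by elim: T => [|[|? ?] IHl [|? ?] IHr] //=; rewrite ?IHl ?IHr. Qed.

(** Splicing out a node of outdegree 1 neither creates nor destroys a leaf, and a nonempty subtree
    never compresses to the empty one, so nodes of outdegree 2 keep both children. *)
Lemma nleaves_compress (T : btree) : nleaves (compress T) = nleaves T.
Proof.
elim: T => // l IHl r IHr; rewrite nleaves_node -IHl -IHr.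
case: l r {IHl IHr} => [|l1 l2] [|r1 r2]; rewrite ?addn0 //.
set l := BNode l1 l2; set r := BNode r1 r2.
rewrite -[compress (BNode l r)]/(BNode (compress l) (compress r)).
by rewrite nleaves_node !compress_eq_empty.
Qed.

Fixpoint bsize (T : btree) : nat :=
  if T is BNode l r then (bsize l + bsize r).+1 else 0%N.

Lemma bsize_fringe_le (T : btree) (v : seq bool) :
  (bsize (fringe T v) <= bsize T)%N.
Proof.
elim: T v => [|l IHl r IHr] [|b v] //=.
case: b; [apply: leq_trans (IHr _) _|apply: leq_trans (IHl _) _]; lia.
Qed.

Lemma nfringe_node (t l r : btree) :
  nfringe t (BNode l r) =
  ((BNode l r == t) + (nfringe t l + nfringe t r))%N.
Proof. by rewrite /nfringe /= count_cat !count_map. Qed.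

Lemma nfringe_large (t T : btree) : (bsize T < bsize t)%N -> nfringe t T = 0%N.
Proof.
move=> ltTt; apply/eqP; rewrite -leqn0 leqNgt -has_count -all_predC.
apply/allP => v _ /=; apply/eqP => E; have := bsize_fringe_le T v; rewrite E; lia.
Qed.

(** Induction on [T]. If [T] is [t], the root copy contains every leaf, and the strictly smaller
    subtrees contain no further copy. Otherwise every copy lies inside one of the two subtrees, and
    both sides are additive. *)
Lemma count_in_copy (t T : btree) :
  count (in_copy t T) (leaves T) = (nleaves t * nfringe t T)%N.
Proof.
elim: T => [|l IHl r IHr]; first by rewrite muln0.
rewrite nfringe_node; have [<-|neq] := eqVneq (BNode l r) t.
  rewrite !nfringe_large /= ?addn0 ?muln1; [|lia|lia].
  rewrite -[RHS]/(size (leaves (BNode l r))) -count_predT; apply: eq_count => v.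
  by rewrite /in_copy /= eqxx prefix0s.
(* A copy rooted in the other subtree has an address with the opposite first step, which is no
   prefix of [b :: v]. *)
have cons b v : in_copy t (BNode l r) (b :: v) = in_copy t (if b then r else l) v.
  rewrite /in_copy /= (negbTE neq) /= has_cat !has_map.
  by case: b; [|rewrite orbC]; rewrite [X in X || _](_ : _ = false) => //;
    apply/negbTE; rewrite -all_predC; apply/allP => w _ /=; rewrite andbF.
have nil : in_copy t (BNode l r) [::] = false.
  rewrite /in_copy /= (negbTE neq) /= has_cat !has_map; apply/negbTE.
  by rewrite negb_or -!all_predC; apply/andP; split;
    apply/allP => w _ /=; rewrite andbF.
rewrite add0n mulnDr -IHl -IHr /leaves /= filter_cat !filter_map.
(* [b] stands for the test whether the root is itself a leaf; by [nil] such a root would not be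
   counted. *)
have -> : forall b (s1 s2 : seq (seq bool)), count (in_copy t (BNode l r))
   (if b then [::] :: s1 ++ s2 else s1 ++ s2) =
   (count (in_copy t (BNode l r)) s1 + count (in_copy t (BNode l r)) s2)%N.
  by case=> s1 s2 /=; rewrite count_cat ?nil.
by rewrite !count_map; congr addn; apply: eq_count => v /=; rewrite cons.
Qed.

Lemma q_given_compress (R : realType) (t T : btree) :
  q_given R t (compress T) =
  (nleaves t * nfringe t (compress T))%:R / (nleaves T)%:R.
Proof. by rewrite /q_given count_in_copy nleaves_compress. Qed.

Lemma q_given_ge0 (R : realType) (t T : btree) : 0 <= q_given R t T.
Proof. by rewrite divr_ge0. Qed.

Lemma q_given_le1 (R : realType) (t T : btree) : q_given R t T <= 1.
Proof.
rewrite /q_given; have [->|nz] := eqVneq (nleaves T) 0%N.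
  by rewrite invr0 mulr0.
by rewrite ler_pdivrMr ?ltr0n ?lt0n// mul1r ler_nat count_size.
Qed.

(** * The law of the random search tree *)

(** The law depends on the keys only through their number: [k] is the number of keys below the
    pivot, uniform on [0, ..., n - 1]. *)
Fixpoint bst_prob_size (R : realType) (T : btree) (n : nat) : R :=
  if T is BNode l r then
    n%:R^-1 * \sum_(k < n) bst_prob_size R l k * bst_prob_size R r (n - k.+1)
  else (n == 0%N)%:R.

(** The rank is strictly increasing in the key, hence injective on [s], and it is below [size s]
    because a key does not precede itself; an injection between finite sets of equal size is a
    bijection. *)
Lemma perm_ranks (R : realType) (s : seq R) : uniq s ->
  perm_eq [seq size [seq y <- s | y < x] | x <- s] (iota 0 (size s)).
Proof.
move=> us; have inj : {in s &, injective (fun x => size [seq y <- s | y < x])}.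
  suff lt x y : x \in s -> x < y ->
      (size [seq z <- s | (z < x)%R] < size [seq z <- s | (z < y)%R])%N.
    move=> x y xs ys; have [xy|yx|//] := ltgtP x y.
      by have := lt _ _ xs xy; lia.
    by have := lt _ _ ys yx; lia.
  move=> xs xy; rewrite !size_filter.
  have -> : count (fun z => z < y) s =
     (count (fun z => (z < x)%R) s + count (fun z => (x <= z < y)%R) s)%N.
    rewrite -count_predUI [X in (_ + X)%N](_ : _ = 0%N) ?addn0.
      apply: eq_count => z /=; have [zx|xz] := ltP z x; last by [].
      by rewrite (lt_trans zx xy).
    by rewrite -(count_pred0 s); apply: eq_count => z /=; case: ltP.
  rewrite -addn1 leq_add2l -has_count; apply/hasP; exists x => //=.
  by rewrite lexx.
apply: uniq_perm; rewrite ?iota_uniq ?map_inj_in_uniq//.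
have sub : {subset [seq size [seq y <- s | (y < x)%R] | x <- s]
                     <= iota 0 (size s)}; last first.
  have [] := uniq_min_size _ sub; rewrite ?map_inj_in_uniq ?size_iota ?size_map//.
move=> _ /mapP[x xs ->].
rewrite mem_iota /= add0n -(count_predC (fun y => y < x) s) size_filter.
rewrite -addn1 leq_add2l -has_count; apply/hasP; exists x => //=.
by rewrite ltxx.
Qed.

Lemma size_filter_gt (R : realType) (s : seq R) (x : R) : uniq s -> x \in s ->
  size [seq y <- s | x < y] = (size s - (size [seq y <- s | (y < x)%R]).+1)%N.
Proof.
move=> us xs; rewrite !size_filter -(count_predC (fun y => y < x) s).
suff -> : count (predC (fun y => (y < x)%R)) s = (count (fun y => (x < y)%R) s).+1.
  by lia.
have x1 : count_mem x s = 1%N by rewrite count_uniq_mem ?xs.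
rewrite -add1n -{1}x1.
rewrite -count_predUI [X in (_ + X)%N](_ : _ = 0%N) ?addn0.
  by apply: eq_count => y /=; case: ltgtP.
by rewrite -(count_pred0 s); apply: eq_count => y /=; case: ltgtP.
Qed.

Lemma bst_probE (R : realType) (T : btree) (s : seq R) :
  uniq s -> bst_prob T s = bst_prob_size R T (size s).
Proof.
elim: T s => [|l IHl r IHr] s us /=; first by rewrite size_eq0.
congr (_ * _); rewrite -(big_mkord xpredT (fun k =>
  bst_prob_size R l k * bst_prob_size R r (size s - k.+1))).
rewrite /index_iota subn0 -(perm_big _ (perm_ranks us)) big_map.
rewrite big_seq [RHS]big_seq; apply: eq_bigr => x xs.
by rewrite IHl ?IHr ?filter_uniq// (size_filter_gt us xs).
Qed.

Lemma bst_prob_size_ge0 (R : realType) (T : btree) (n : nat) :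
  0 <= bst_prob_size R T n.
Proof.
elim: T n => [|l IHl r IHr] n /=; first exact: ler0n.
by rewrite mulr_ge0 ?invr_ge0// sumr_ge0// => k _; rewrite mulr_ge0.
Qed.

(** The trees with at most [h] levels, hence all trees with at most [h] nodes. For [n <= h] this
    finite list supports the law, so expectations are finite sums. *)
Fixpoint trees (h : nat) : seq btree :=
  if h is h'.+1 then
    BEmpty :: [seq BNode l r | l <- trees h', r <- trees h']
  else [:: BEmpty].

Lemma trees_uniq (h : nat) : uniq (trees h).
Proof.
elim: h => // h IH /=; apply/andP; split.
  by apply/negP => /allpairsP[[l r] [_ _]].
by apply: allpairs_uniq => // -[a b] [c e] _ _ /= [-> ->].
Qed.

(* The expectation of [f] over the random search tree on [n] numbers, as soon
   as [n <= h]. *)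
Definition bst_mean (R : realType) (h n : nat) (f : btree -> R) : R :=
  \sum_(T <- trees h) bst_prob_size R T n * f T.

Lemma bst_mean0 (R : realType) (h : nat) (f : btree -> R) :
  bst_mean h 0 f = f BEmpty.
Proof.
rewrite /bst_mean; case: h => [|h] /=; first by rewrite big_seq1 mul1r.
rewrite big_cons mul1r big_allpairs_dep big1 ?addr0// => l _.
by rewrite big1//= => r _; rewrite big_ord0 mulr0 mul0r.
Qed.

(** Conditioning on the rank [k] of the pivot, which leaves independent subtrees on [k] and [n - k]
    keys. *)
Lemma bst_meanS (R : realType) (h n : nat) (f : btree -> R) :
  bst_mean h.+1 n.+1 f =
  n.+1%:R^-1 * \sum_(k < n.+1) bst_mean h k (fun l =>
                bst_mean h (n - k) (fun r => f (BNode l r))).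
Proof.
rewrite /bst_mean /= big_cons mul0r add0r big_allpairs_dep.
under eq_bigr do rewrite -/trees.
under [in RHS]eq_bigr => k _.
  under eq_bigr do rewrite mulr_sumr.
  over.
rewrite [in RHS]exchange_big mulr_sumr; apply: eq_bigr => l _.
rewrite [in RHS]exchange_big mulr_sumr; apply: eq_bigr => r _.
rewrite -mulrA mulr_suml; congr (_ * _); apply: eq_bigr => k _.
by rewrite subSS mulrA.
Qed.

Lemma bst_prob_size_neq0 (R : realType) (T : btree) (n : nat) :
  bst_prob_size R T n != 0 -> bsize T = n.
Proof.
elim: T n => [|l IHl r IHr] n /=.
  by case: n => //=; rewrite eqxx.
apply: contra_neq_eq => /eqP ne; rewrite big1 ?mulr0// => k _; apply/eqP.
rewrite mulf_eq0 -[_ || _]negbK negb_or; apply/negP => /andP[/IHl sl /IHr sr].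
by have := ltn_ord k; lia.
Qed.

Lemma eq_bst_mean (R : realType) (h n : nat) (f g : btree -> R) :
  (forall T, bsize T = n -> f T = g T) -> bst_mean h n f = bst_mean h n g.
Proof.
move=> fg; apply: eq_bigr => T _.
have [->|/bst_prob_size_neq0/fg -> //] := eqVneq (bst_prob_size R T n) 0.
by rewrite !mul0r.
Qed.

Lemma bst_meanD (R : realType) (h n : nat) (f g : btree -> R) :
  bst_mean h n (fun T => f T + g T) = bst_mean h n f + bst_mean h n g.
Proof. by rewrite -big_split; apply: eq_bigr => T _; rewrite mulrDr. Qed.

Lemma bst_meanZ (R : realType) (h n : nat) (c : R) (f : btree -> R) :
  bst_mean h n (fun T => c * f T) = c * bst_mean h n f.
Proof. by rewrite /bst_mean mulr_sumr; apply: eq_bigr => T _; rewrite mulrCA. Qed.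

Lemma bst_mean1 (R : realType) (h n : nat) : (n <= h)%N ->
  bst_mean h n (fun=> 1 : R) = 1.
Proof.
elim: h n => [|h IH] [|n] //; rewrite ?bst_mean0// bst_meanS ltnS => nh.
rewrite (eq_bigr (fun=> 1)) => [|k _].
  by rewrite sumr_const card_ord mulVf// pnatr_eq0.
rewrite (@eq_bst_mean _ _ _ _ (fun=> 1)); last first.
  by move=> l _; apply: IH; apply: leq_trans (leq_subr _ _) nh.
by apply: IH; apply: leq_trans nh; rewrite -ltnS.
Qed.

Lemma bst_mean_cst (R : realType) (h n : nat) (c : R) : (n <= h)%N ->
  bst_mean h n (fun=> c) = c.
Proof.
move=> nh; rewrite -[RHS]mulr1 -(@bst_mean1 R _ _ nh) -bst_meanZ.
by apply: eq_bst_mean => T _; rewrite mulr1.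
Qed.

(** One recursion for both moments of an additive functional [D]: [g = D], [u = 0] gives the mean,
    and [g = D ^+ 2], [u = D] the second moment. Independence factors the cross term, and the
    symmetry between [k] and [n - k] merges the two sums of [g]. *)
Lemma bst_mean_node (R : realType) (h n : nat) (f g u : btree -> R) :
  (n <= h)%N -> (0 < n)%N ->
  (forall l r, (0 < bsize l + bsize r)%N ->
    f (BNode l r) = g l + g r + 2 * (u l * u r)) ->
  bst_mean h.+1 n.+1 f =
  2 / n.+1%:R * (\sum_(k < n.+1) bst_mean h k g +
                 \sum_(k < n.+1) bst_mean h k u * bst_mean h (n - k) u).
Proof.
move=> nh n0 fg; rewrite bst_meanS.
rewrite (eq_bigr (fun k : 'I_n.+1 => bst_mean h k g + bst_mean h (n - k) g +
    2 * (bst_mean h k u * bst_mean h (n - k) u))).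
  rewrite big_split big_split /= [X in _ * (_ + X + _)](reindex_inj rev_ord_inj) /=.
  rewrite [X in _ + X + _](eq_bigr (fun k : 'I_n.+1 => bst_mean h k g)).
    by rewrite -mulr_sumr; ring.
  by move=> k _; rewrite subSS subKn// -ltnS.
move=> k _; have kn : (k <= n)%N by rewrite -ltnS.
(* Terms constant in [l], and below those constant in [r], are written as means, so that the
   identity can be checked pointwise for subtrees of sizes [k] and [n - k]. *)
rewrite -[X in _ + X + _](@bst_mean_cst _ h k) ?(leq_trans kn)//.
rewrite [bst_mean h k u * _]mulrC -!bst_meanZ -!bst_meanD.
apply: eq_bst_mean => l sl.
rewrite -[X in X + _ + _](@bst_mean_cst _ h (n - k)) ?(leq_trans (leq_subr _ _))//.
rewrite [_ * u l]mulrC -!bst_meanZ -!bst_meanD; apply: eq_bst_mean => r sr.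
by apply: fg; lia.
Qed.

(** * The number of leaves *)

(** The centring is a third of the number of absent children, which is one more than the number of
    nodes and is additive over the two subtrees. *)
Definition leaf_dev (R : realType) (T : btree) : R :=
  (nleaves T)%:R - (bsize T).+1%:R / 3.

Lemma leaf_dev_node (R : realType) (l r : btree) : (0 < bsize l + bsize r)%N ->
  leaf_dev R (BNode l r) = leaf_dev R l + leaf_dev R r.
Proof.
move=> n0; rewrite /leaf_dev nleaves_node ifF; last first.
  by case: l r n0 => [|? ?] [|? ?] //=.
by rewrite natrD /= -!natr1 natrD; ring.
Qed.

Definition leaf_mean (R : realType) (n : nat) : R :=
  match n with 0%N => - 3^-1 | 1%N => 3^-1 | _ => 0 end.

Lemma leaf_dev_empty (R : realType) : leaf_dev R BEmpty = - 3^-1.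
Proof. by rewrite /leaf_dev /= sub0r mul1r. Qed.

Lemma leaf_dev_single (R : realType) : leaf_dev R (BNode BEmpty BEmpty) = 3^-1.
Proof. by rewrite /leaf_dev nleaves_node /=; lra. Qed.

Lemma bst_mean_single (R : realType) (h : nat) (f : btree -> R) :
  bst_mean h.+1 1 f = f (BNode BEmpty BEmpty).
Proof. by rewrite bst_meanS big_ord_recl big_ord0 !bst_mean0 invr1 mul1r addr0. Qed.

(** From two keys on, the recursion averages the earlier means, whose only nonzero values, at 0 and
    1 keys, cancel. *)
Lemma mean_leaf_dev (R : realType) (h n : nat) : (n <= h)%N ->
  bst_mean h n (leaf_dev R) = leaf_mean R n.
Proof.
elim: h n => [|h IH] [|[|n]] nh //;
  rewrite ?bst_mean0 ?bst_mean_single ?leaf_dev_empty ?leaf_dev_single//.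
rewrite (@bst_mean_node _ _ _ _ (leaf_dev R) (fun=> 0))//; last first.
  by move=> l r lr; rewrite leaf_dev_node// !mulr0 addr0.
rewrite [X in _ + X]big1 => [|k _]; last first.
  by rewrite [X in X * _](_ : _ = 0) ?mul0r//; apply: big1 => T _; rewrite mulr0.
rewrite (eq_bigr (fun k : 'I_n.+2 => leaf_mean R k)) => [|k _]; last first.
  by apply: IH; have := ltn_ord k; lia.
by rewrite !big_ord_recl big1//= !addr0 addNr mulr0.
Qed.

(** A term vanishes unless both sizes are at most 1, so only the totals 1 and 2 contribute, with
    sums [- 2 / 9] and [1 / 9]. *)
Lemma leaf_mean_convolution (R : realType) (n : nat) :
  \sum_(k < n.+2) leaf_mean R k * leaf_mean R (n.+1 - k) <= 9^-1.
Proof.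
rewrite !big_ord_recl; case: n => [|[|n]].
- by rewrite big_ord0 /=; lra.
- by rewrite !big_ord_recl big_ord0 /=; lra.
- by rewrite big1 /= => [|k _]; [lra|rewrite mul0r].
Qed.

Lemma mean_leaf_dev_sqr (R : realType) (h n : nat) : (n <= h)%N ->
  bst_mean h n (fun T => leaf_dev R T ^+ 2) <= n.+1%:R.
Proof.
elim: h n => [|h IH] [|[|n]] nh //;
  rewrite ?bst_mean0 ?bst_mean_single ?leaf_dev_empty ?leaf_dev_single//; try lra.
rewrite (@bst_mean_node _ _ _ _ (fun T => leaf_dev R T ^+ 2) (leaf_dev R))//;
  last by move=> l r lr; rewrite leaf_dev_node//; ring.
rewrite [X in _ + X](eq_bigr (fun k : 'I_n.+2 =>
    leaf_mean R k * leaf_mean R (n.+1 - k))); last first.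
  by move=> k _; have := ltn_ord k => kn; rewrite !mean_leaf_dev//; lia.
have succ k : k.+1%:R = k%:R + 1 :> R by rewrite natr1.
have := leaf_mean_convolution R n; set C := \sum_(k < n.+2) _ * _ => C_le.
(* The term [k = 0] keeps its exact value [1 / 9]; with the inductive bound 1 in its place the
   induction would not close. *)
rewrite big_ord_recl bst_mean0 leaf_dev_empty.
(* The inductive bounds add up to [2 + 3 + ... + (n + 2)]. *)
have S_le : \sum_(k < n.+1) bst_mean h (lift ord0 k) (fun T => leaf_dev R T ^+ 2)
    <= n.+1%:R * n.+4%:R / 2.
  apply: (@le_trans _ _ (\sum_(k < n.+1) (k.+2)%:R)).
    by apply: ler_sum => k _; apply: IH; have := ltn_ord k; rewrite lift0; lia.
  elim: (n) => [|m IHm]; first by rewrite big_ord_recl big_ord0 /=; lra.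
  rewrite big_ord_recr /=; apply: le_trans (lerD IHm (lexx _)) _.
  by rewrite (succ m.+4) (succ m.+3) (succ m.+2) (succ m.+1) (succ m); lra.
set S := \sum_(k < n.+1) _ in S_le *.
(* What remains is [(n + 1) (n + 4) + 4 / 9 <= (n + 2) (n + 3)]. *)
rewrite mulrAC ler_pdivrMr ?ltr0n//; move: S_le.
by rewrite (succ n.+3) (succ n.+2) (succ n.+1) (succ n); lra.
Qed.

Lemma bst_mean_markov (R : realType) (n : nat) (a : R) : 0 < a ->
  bst_mean n n (fun T => (a <= `|leaf_dev R T|)%R%:R) <= n.+1%:R / a ^+ 2.
Proof.
move=> a0; rewrite ler_pdivlMr ?exprn_gt0// mulrC -bst_meanZ.
apply: le_trans (@mean_leaf_dev_sqr R n n (leqnn n)).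
apply: ler_sum => T _; apply: ler_wpM2l; first exact: bst_prob_size_ge0.
have [aD|_] := boolP (a <= `|leaf_dev R T|); last by rewrite mulr0 sqr_ge0.
by rewrite mulr1 -[leRHS]real_normK ?num_real// ler_pXn2r ?nnegrE// ltW.
Qed.

(** * From finite sums over trees to probabilities of events *)

Section random_bst.
Context (R : realType) (d : measure_display) (Om : measurableType d).
Context (P : probability Om R) (B : {RV P >-> btree}) (n : nat).
Context (s : n.-tuple R) (s_uniq : uniq s) (B_bst : is_random_bst s B).

Lemma measurable_preimage_bst (Q : set btree) :
  measurable [set w | Q (B w)].
Proof. by rewrite -[X in measurable X]setTI; exact: measurable_funPT. Qed.

Lemma prob_bst_seq (Q : pred btree) (ts : seq btree) : uniq ts ->
  P [set w | (B w \in ts) && Q (B w)] =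
  (\sum_(T <- ts) bst_prob_size R T n * (Q T)%:R)%:E.
Proof.
elim: ts => [_|T ts IH /= /andP[nT uts]].
  by rewrite big_nil (_ : [set _ | _] = set0) ?measure0// -subset0.
have -> : [set w | (B w \in T :: ts) && Q (B w)] =
    [set w | B w == T /\ Q T] `|` [set w | (B w \in ts) && Q (B w)].
  apply/seteqP; split => w /=; rewrite inE.
    by case/andP => /orP[/eqP <-|->] ->; [left|right].
  by case=> [[/eqP -> ->]|/andP[-> ->]]; rewrite ?eqxx ?orbT.
rewrite measureU; last 3 first.
- exact: (measurable_preimage_bst (fun T' => T' == T /\ Q T)).
- exact: (measurable_preimage_bst (fun T' => (T' \in ts) && Q T')).
- by rewrite -subset0 => w [] /= [/eqP -> _] /andP[]; rewrite (negbTE nT).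
rewrite [X in (_ + X)%E](IH uts) big_cons EFinD; congr (_ + _)%E.
case: (Q T); rewrite ?mulr1 ?mulr0; last first.
  by rewrite (_ : [set _ | _] = set0) ?measure0// -subset0 => w [].
have := B_bst T; rewrite bst_probE// size_tuple => <-.
by congr (P _); apply/seteqP; split => w /=; [case=> /eqP|move/eqP].
Qed.

(** The trees in [trees n] already carry total mass 1, so the rest of the event is null and finite
    additivity over the list suffices. *)
Lemma prob_bst (Q : pred btree) :
  P [set w | Q (B w)] = (bst_mean n n (fun T => (Q T)%:R : R))%:E.
Proof.
have mem1 : P [set w | B w \in trees n] = 1%E.
  have := prob_bst_seq predT (trees_uniq n).
  rewrite -/(bst_mean n n (fun=> 1)) bst_mean1// => <-.
  by congr (P _); apply/seteqP; split => w /=; rewrite andbT.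
have mem0 : P [set w | B w \notin trees n] = 0%E.
  rewrite (_ : [set _ | _] = ~` [set w | B w \in trees n]).
    by rewrite probability_setC ?mem1 ?subee//;
      exact: (measurable_preimage_bst (fun T => T \in trees n)).
  by apply/seteqP; split => w /= /negP.
rewrite -(prob_bst_seq Q (trees_uniq n)).
rewrite (_ : [set w | Q (B w)] = [set w | (B w \in trees n) && Q (B w)] `|`
   [set w | (B w \notin trees n) && Q (B w)]); last first.
  by apply/seteqP; split => w /=; case: (B w \in trees n) => //=;
    [left|right|case|case].
rewrite measureU; last 3 first.
- exact: (measurable_preimage_bst (fun T => (T \in trees n) && Q T)).
- exact: (measurable_preimage_bst (fun T => (T \notin trees n) && Q T)).
- by rewrite -subset0 => w [/= /andP[->]].
rewrite [X in (_ + X)%E](_ : _ = 0%E) ?adde0//.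
apply: subset_measure0 mem0.
- exact: (measurable_preimage_bst (fun T => (T \notin trees n) && Q T)).
- exact: (measurable_preimage_bst (fun T => T \notin trees n)).
- by move=> w /= /andP[].
Qed.

Lemma prob_leaf_dev (a : R) : 0 < a ->
  (P [set w | (a <= `|(nleaves (B w))%:R - n.+1%:R / 3|)%R]
     <= (n.+1%:R / a ^+ 2)%:E)%E.
Proof.
move=> a0; have := prob_bst (fun T => a <= `|(nleaves T)%:R - n.+1%:R / 3|).
move=> ->; rewrite lee_fin; apply: le_trans (bst_mean_markov n a0).
rewrite le_eqVlt; apply/orP; left; apply/eqP; apply: eq_bst_mean => T sT.
by rewrite /leaf_dev sT.
Qed.

End random_bst.

(** * Tightness and convergence *)

Lemma normal_prob_itv_le (R : realType) (sigma x y : R) :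
  sigma != 0 -> x <= y ->
  (normal_prob 0 sigma `]x, y] <= (normal_peak sigma * (y - x))%:E)%E.
Proof.
move=> s0 xy; apply: (@le_trans _ _
  (\int[lebesgue_measure]_(z in `]x, y]%classic) (normal_peak sigma)%:E)%E).
  apply: ge0_le_integral => //=.
  - by move=> z _; rewrite lee_fin normal_pdf_ge0.
  - by apply/measurable_EFinP/measurable_funTS; exact: measurable_normal_pdf.
  - by move=> z _; rewrite lee_fin normal_pdf_ub.
by rewrite integral_cst//= lebesgue_measure_itv/= lte_fin;
  case: ltP => [_|yx]; rewrite ?EFinM// mule0 lee_fin mulr_ge0 ?normal_peak_ge0 ?subr_ge0.
Qed.

(** The distribution function is nondecreasing, and Lipschitz with the peak of the density as
    constant. *)
Lemma continuous_normal_cdf (R : realType) (sigma : R) : sigma != 0 ->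
  continuous (fun y : R => normal_prob 0 sigma `]-oo, y]).
Proof.
move=> s0.
have lip (x y : R) : x <= y -> fine (normal_prob 0 sigma `]-oo, y]) <=
    fine (normal_prob 0 sigma `]-oo, x]) + normal_peak sigma * (y - x).
  move=> xy; rewrite -lee_fin EFinD !fineK ?fin_num_measure//.
  rewrite (_ : `]-oo, y]%classic = `]-oo, x]%classic `|` `]x, y]%classic).
    apply: le_trans (measureU2 _ _ _) _ => //.
    by apply: leeD2l; exact: normal_prob_itv_le.
  by rewrite -itv_bndbnd_setU// bnd_simp.
have mono (x y : R) : x <= y -> fine (normal_prob 0 sigma `]-oo, x]) <=
    fine (normal_prob 0 sigma `]-oo, y]).
  move=> xy; apply: fine_le; rewrite ?fin_num_measure//.
  apply: le_measure; rewrite ?inE//.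
  by apply: subset_itvl; rewrite bnd_simp.
move=> x; rewrite /continuous_at -[X in _ --> X]fineK ?fin_num_measure//.
apply: cvg_EFin; first by apply: nearW => y; rewrite fin_num_measure.
have M0 := normal_peak_gt0 s0; apply/cvgrPdist_le => e e0; near=> y.
have close : `|x - y| <= e / normal_peak sigma.
  by near: y; apply: cvgr_dist_le; [exact: cvg_id|exact: divr_gt0].
move: close; rewrite ler_pdivlMr// mulrC => close /=.
have [xy|/ltW yx] := leP x y.
  have := lip _ _ xy; have := mono _ _ xy.
  move: close; rewrite (distrC x) (ger0_norm (_ : 0 <= y - x)) ?subr_ge0//.
  by rewrite ler_norml; lra.
have := lip _ _ yx; have := mono _ _ yx.
by move: close; rewrite (ger0_norm (_ : 0 <= x - y)) ?subr_ge0// ler_norml; lra.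
Unshelve. all: by end_near. Qed.

(** Convergence in distribution may be evaluated only at continuity points, so the cut-offs [- K]
    and [K] must be such points. For variance 0 the only jump is at 0 and [K = 1] works; otherwise
    every point is admissible and the limits of the distribution function at infinity give [K]. *)
Lemma centred_normal_tails (R : realType) (sigma e : R) : 0 < e ->
  exists2 K : R, 0 < K &
  [/\ {for - K, continuous (fun y : R => centred_normal sigma `]-oo, y])},
      {for K, continuous (fun y : R => centred_normal sigma `]-oo, y])},
      (centred_normal sigma `]-oo, (- K)%R] < e%:E)%E &
      ((1 - e)%:E < centred_normal sigma `]-oo, K])%E].
Proof.
move=> e0; have [->|s0] := eqVneq sigma 0.
  have cdfE : (fun y : R => centred_normal 0 `]-oo, y]) =
      (fun y => ((0 <= y)%R%:R)%:E).
    by apply/funext => y; rewrite /centred_normal eqxx diracE mem_setE in_itv.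
  have cst (c : R) : c != 0 ->
      {for c, continuous (fun y : R => ((0 <= y)%R%:R)%:E : \bar R)}.
    rewrite neq_lt => /orP[c0|c0]; apply: cvg_near_cst; near=> y;
      congr (_%:R%:E).
      have y0 : y < 0 by near: y; exact: lt_nbhsl.
      by rewrite !leNgt c0 y0.
    have y0 : 0 < y by near: y; exact: lt_nbhsr.
    by rewrite (ltW c0) (ltW y0).
  exists 1 => //; split.
  - by rewrite cdfE; apply: cst; rewrite oppr_eq0.
  - by rewrite cdfE; apply: cst.
  - by have /(congr1 (@^~ (- 1))) /= -> := cdfE; rewrite ler0N1 lte_fin.
  - by have /(congr1 (@^~ 1)) /= -> := cdfE; rewrite ler01 lte_fin gtrBl.
rewrite /centred_normal (negbTE s0).
have idP : (idfun : measurableTypeR R -> R) \in mfun.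
  by rewrite inE; exact: measurable_id.
(* The identity variable has the normal law, which makes the limit theorems for [cdf] applicable. *)
pose X : {RV (normal_prob 0 sigma : probability (measurableTypeR R) R) >-> R} :=
  mfun_Sub idP.
have cdfE x : cdf X x = normal_prob 0 sigma `]-oo, x]%classic by [].
have := @cvg_cdfNy0 _ _ _ _ X; rewrite (funext cdfE).
have e0' : (0%E < e%:E)%E by rewrite lte_fin.
move=> /(_ _ (open_ereal_lt' e0')) [A [_ lo]].
have := @cvg_cdfy1 _ _ _ _ X; rewrite (funext cdfE).
have e1' : ((1 - e)%:E < 1%E)%E by rewrite lte_fin gtrBl.
move=> /(_ _ (open_ereal_gt' e1')) [C [_ hi]].
pose K := 1 + `|A| + `|C|; exists K; first by rewrite /K !ltr_wpDr.
split; [exact: continuous_normal_cdf|exact: continuous_normal_cdf| |].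
  apply: lo; rewrite /K; have := ler_norm (- A); have := normr_ge0 C.
  by rewrite normrN; lra.
by apply: hi; rewrite /K; have := ler_norm C; have := normr_ge0 A; lra.
Unshelve. all: by end_near. Qed.

Section convergence.
Context (R : realType) (d : nat -> measure_display).
Context (Om : forall n, measurableType (d n)) (P : forall n, probability (Om n) R).

Lemma tight_of_cvg_in_distribution (X : forall n, Om n -> R) (sigma : R) :
  (forall n, measurable_fun setT (X n)) ->
  cvg_in_distribution P X (centred_normal sigma) ->
  forall e : R, 0 < e -> exists2 K : R, 0 < K &
    \forall n \near \oo, (P n [set w | K < `|X n w|]%R <= e%:E)%E.
Proof.
move=> mX cvgX e e0; have e2 : 0 < e / 2 by rewrite divr_gt0.
have [K K0 [cNK cK lo hi]] := centred_normal_tails sigma e2.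
exists K => //.
have := cvgX _ cNK => /(_ _ (open_ereal_lt' lo)) loN.
have := cvgX _ cK => /(_ _ (open_ereal_gt' hi)) hiN.
have mle n x : measurable [set w | X n w <= x].
  rewrite (_ : [set _ | _] = X n @^-1` `]-oo, x]%classic).
    by rewrite -[X in measurable X]setTI; exact: mX.
  by apply/seteqP; split => w /=; rewrite in_itv.
near=> n.
have loP : (P n [set w | (X n w <= - K)%R] < (e / 2)%:E)%E by near: n.
have hiP : ((1 - e / 2)%:E < P n [set w | (X n w <= K)%R])%E by near: n.
have mlt : measurable [set w | K < `|X n w|].
  rewrite (_ : [set _ | _] = (fun w => `|X n w|) @^-1` `]K, +oo[%classic).
    have mn : measurable_fun setT (fun w => `|X n w|).
      exact: measurableT_comp.
    by rewrite -[X in measurable X]setTI; exact: mn.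
  by apply/seteqP; split => w /=; rewrite in_itv/= andbT.
apply: (@le_trans _ _ (P n [set w | (X n w <= - K)%R]
    + P n (~` [set w | (X n w <= K)%R]))%E).
  apply: le_trans (measureU2 _ _ _); [|exact: mle|exact/measurableC/mle].
  apply: le_measure; rewrite ?inE//.
    by apply: measurableU; [exact: mle|exact/measurableC/mle].
  move=> w /=; rewrite lter_normr => /orP[KX|KX]; [right|left].
    by apply/negP; rewrite -ltNge.
  by rewrite lerNr ltW.
rewrite probability_setC//.
have fin n' : P n' [set w | X n' w <= K] \is a fin_num by rewrite fin_num_measure.
rewrite (splitr e) EFinD; apply: leeD; first exact: ltW.
move: hiP; rewrite -(fineK (fin n)) -EFinB lte_fin lee_fin; lra.
Unshelve. all: by end_near. Qed.

Lemma cvg_measure0P (E : forall n, set (Om n)) :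
  (fun n => P n (E n)) @ \oo --> 0%E <->
  forall e : R, 0 < e -> \forall n \near \oo, (P n (E n) <= e%:E)%E.
Proof.
split=> [cvgE e e0|small].
  have e0' : (0%E < e%:E)%E by rewrite lte_fin.
  have /(_ _ (open_ereal_lt' e0')) := cvgE; rewrite !near_simpl.
  by apply: filterS => n /ltW.
apply: cvg_EFin.
  apply: filterS (small _ ltr01) => n PE.
  by rewrite ge0_fin_numE// (le_lt_trans PE)// ltry.
apply/cvgrPdist_le => e e0; apply: filterS (small _ e0) => n PE /=.
rewrite sub0r normrN ger0_norm ?fine_ge0// -lee_fin fineK//.
by rewrite ge0_fin_numE// (le_lt_trans PE)// ltry.
Qed.

Lemma measurable_affine_indic (n : nat) (a M : R) (A : set (Om n)) :
  measurable A -> measurable_fun setT (fun w => (a + M * \1_A w)%:E).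
Proof.
move=> mA; apply/measurable_EFinP/measurable_funD => //.
by apply: measurable_funM => //; exact: measurable_indic.
Qed.

Lemma integral_affine_indic (n : nat) (a M : R) (A : set (Om n)) :
  0 <= a -> 0 <= M -> measurable A ->
  (\int[P n]_w (a + M * \1_A w)%:E = a%:E + M%:E * P n A)%E.
Proof.
move=> a0 M0 mA; under eq_integral do rewrite EFinD EFinM.
rewrite ge0_integralD//=.
- rewrite integral_cst//= probability_setT mule1 ge0_integralZl//.
  + by rewrite integral_indic// setIT.
  + by apply/measurable_EFinP; exact: measurable_indic.
- by move=> w _; rewrite mule_ge0// lee_fin.
- by apply/measurable_EFinP/measurable_funM => //; exact: measurable_indic.
Qed.

(** Bounded convergence: with [A] the event that [X n] is at distance at least [e / 2] from [c], the
    distance is at most [e / 2 + (1 + c) * \1_A] everywhere, since [X n] lies in [[0, 1]]. *)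
Lemma cvg_expectation_of_cvg_in_probability (X : forall n, Om n -> R) (c : R) :
  0 <= c ->
  (forall n, measurable_fun setT (X n)) -> (forall n w, 0 <= X n w <= 1) ->
  cvg_in_probability P X c ->
  (fun n => fine 'E_(P n)[X n]) @ \oo --> c.
Proof.
move=> c0 mX X01 cvgX; apply/cvgrPdist_le => e e0.
have e2 : 0 < e / 2 by rewrite divr_gt0.
have M0 : 0 < 1 + c by rewrite ltr_pwDl.
(* This tolerance makes [(1 + c) * P A] at most [e / 2]. *)
have := (cvg_measure0P _).1 (cvgX _ e2) _ (divr_gt0 e2 M0).
apply: filterS => n; set A := [set w | _] => PA.
have mA : measurable A.
  rewrite (_ : A = (fun w => `|X n w - c|) @^-1` `[(e / 2), +oo[%classic).
    rewrite -[X in measurable X]setTI.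
    have mg : measurable_fun setT (fun w => `|X n w - c|).
      by apply: measurableT_comp; [exact: normr_measurable|exact: measurable_funB].
    exact: mg.
  by apply/seteqP; split => w /=; rewrite in_itv/= andbT.
have mXE : measurable_fun setT (fun w => (X n w)%:E) by exact/measurable_EFinP.
have X0 w : 0 <= X n w by case/andP: (X01 n w).
have X1 w : X n w <= 1 by case/andP: (X01 n w).
have indA w : `|X n w - c| < e / 2 \/ \1_A w = 1 :> R.
  have [h|h] := ltP `|X n w - c| (e / 2); [by left|right].
  by rewrite indicE mem_set.
have ind0 w : 0 <= \1_A w :> R by rewrite indicE.
have Mind0 w : 0 <= (1 + c) * \1_A w by rewrite mulr_ge0// ltW.
have [e20 M00] := (ltW e2, ltW M0).
have ce0 : 0 <= c + e / 2 by rewrite addr_ge0.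
have up : ('E_(P n)[X n] <= (c + e / 2)%:E + (1 + c)%:E * P n A)%E.
  rewrite unlock -integral_affine_indic//.
  apply: ge0_le_integral => //=.
  - by move=> w _; rewrite lee_fin.
  - exact: measurable_affine_indic.
  move=> w _; rewrite lee_fin; have := Mind0 w; have := X1 w.
  by case: (indA w) => [|->]; rewrite ?ltr_norml; lra.
(* The error is added on the right rather than subtracted on the left, so that every integrand is
   nonnegative. *)
have lo : (c%:E <= 'E_(P n)[X n] + ((e / 2)%:E + (1 + c)%:E * P n A))%E.
  rewrite unlock -integral_affine_indic//.
  rewrite -ge0_integralD//=; first last.
  - exact: measurable_affine_indic.
  - by move=> w _; rewrite lee_fin addr_ge0.
  - by move=> w _; rewrite lee_fin.
  apply: (@le_trans _ _ (\int[P n]_w c%:E)%E).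
    by rewrite integral_cst//= probability_setT mule1.
  apply: ge0_le_integral => //=.
  - by apply: emeasurable_funD => //; exact: measurable_affine_indic.
  move=> w _; rewrite -EFinD lee_fin; have := Mind0 w; have := X0 w.
  by case: (indA w) => [|->]; rewrite ?ltr_norml; lra.
have MA : ((1 + c)%:E * P n A <= (e / 2)%:E)%E.
  apply: le_trans (lee_wpmul2l _ PA) _; first by rewrite lee_fin.
  by rewrite -EFinM lee_fin [leLHS]mulrC divfK// gt_eqF.
have {}up : ('E_(P n)[X n] <= (c + e)%:E)%E.
  have -> : ((c + e)%:E = (c + e / 2)%:E + (e / 2)%:E)%E.
    by rewrite -EFinD -addrA -splitr.
  by apply: le_trans up _; apply: leeD2l.
have {}lo : (c%:E <= 'E_(P n)[X n] + e%:E)%E.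
  have -> : (e%:E = (e / 2)%:E + (e / 2)%:E)%E by rewrite -EFinD -splitr.
  by apply: le_trans lo _; do 2 apply: leeD2l.
have Efin : ('E_(P n)[X n])%E \is a fin_num.
  by rewrite ge0_fin_numE ?expectation_ge0// (le_lt_trans up)// ltry.
move: up lo; rewrite -(fineK Efin) -EFinD !lee_fin /= ler_norml; lra.
Qed.

End convergence.

(** * The proportion of leaves in fringe copies *)

(** The difference is [((N - n * beta) - 3 * beta * (L - n / 3)) / L], and [eta <= 1 / 6] keeps [L]
    above [n / 6]. *)
Lemma ratio_dev (R : realFieldType) (n N L beta eta : R) :
  0 < n -> 0 <= beta -> eta <= 6^-1 ->
  `|N - n * beta| < eta * n -> `|L - n / 3| < eta * n ->
  `|N / L - 3 * beta| <= 6 * eta * (1 + 3 * beta).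
Proof.
move=> n0 b0 eta6 dN dL.
have eta_n : eta * n <= n / 6 by rewrite mulrC ler_pM2l.
have L6 : n <= 6 * L by move: dL; rewrite ltr_norml; lra.
have L0 : 0 < L by lra.
have -> : N / L - 3 * beta = (N - 3 * beta * L) / L by field; rewrite gt_eqF.
rewrite normrM normfV (gtr0_norm L0) ler_pdivrMr//.
have : `|N - 3 * beta * L| <= eta * n + 3 * beta * (eta * n).
  rewrite (_ : N - _ = (N - n * beta) - 3 * beta * (L - n / 3)); last by field.
  apply: le_trans (ler_normB _ _) _; rewrite lerD ?(ltW dN)// normrM.
  by rewrite ger0_norm ?mulr_ge0// ler_wpM2l ?mulr_ge0// ltW.
move=> /le_trans; apply.
have eta0 : 0 <= eta by rewrite -(pmulr_lge0 _ n0) (le_trans _ (ltW dN)).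
have -> : eta * n + 3 * beta * (eta * n) = eta * (1 + 3 * beta) * n by ring.
have -> : 6 * eta * (1 + 3 * beta) * L = eta * (1 + 3 * beta) * (6 * L) by ring.
by apply: ler_wpM2l => //; rewrite mulr_ge0// addr_ge0// mulr_ge0.
Qed.

(** * Concentration of the two counts and of their ratio *)

Section random_bst_sequence.
Context (R : realType) (d : nat -> measure_display).
Context (Om : forall n, measurableType (d n)) (P : forall n, probability (Om n) R).
Context (B : forall n, {RV P n >-> btree}).

Lemma measurable_bst_fun (f : btree -> R) (n : nat) :
  measurable_fun setT (fun w => f (B n w)).
Proof.
by move=> _ Y _; rewrite setTI; exact: (measurable_preimage_bst (B n) (f @^-1` Y)).
Qed.

Lemma leaves_concentrate (s : forall n, n.-tuple R) :
  (forall n, uniq (s n)) -> (forall n, is_random_bst (s n) (B n)) ->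
  forall eta e : R, 0 < eta -> 0 < e -> \forall n \near \oo,
  (P n [set w | eta * n%:R <= `|(nleaves (B n w))%:R - n%:R / 3|]%R <= e%:E)%E.
Proof.
move=> s_uniq B_bst eta e eta0 e0; near=> n.
have n1 : 1 <= n%:R :> R by near: n; exact: nbhs_infty_ger.
(* [n_eta] lets half of the tolerance absorb the shift of the centre from [n / 3] to [(n + 1) / 3];
   [n_e] brings the Chebyshev bound below [e], by [n + 1 <= 2 * n]. *)
have n_eta : eta^-1 <= n%:R by near: n; exact: nbhs_infty_ger.
have n_e : 8 / (eta ^+ 2 * e) <= n%:R by near: n; exact: nbhs_infty_ger.
have n0 : 0 < n%:R :> R by exact: lt_le_trans n1.
have eta_n : 1 <= eta * n%:R by rewrite mulrC -ler_pdivrMr ?div1r.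
have a0 : 0 < eta * n%:R / 2 by rewrite divr_gt0 ?mulr_gt0.
apply: (@le_trans _ _ (P n
    [set w | (eta * n%:R / 2 <= `|(nleaves (B n w))%:R - n.+1%:R / 3|)%R])).
  apply: le_measure; rewrite ?inE.
  - exact: (measurable_preimage_bst (B n)
      (fun T => eta * n%:R <= `|(nleaves T)%:R - n%:R / 3|)).
  - exact: (measurable_preimage_bst (B n)
      (fun T => eta * n%:R / 2 <= `|(nleaves T)%:R - n.+1%:R / 3|)).
  move=> w /=; rewrite -(natr1 n) !ler_normr => /orP[h|h]; apply/orP; [left|right];
    by move: h eta_n; lra.
apply: le_trans (prob_leaf_dev (s_uniq n) (B_bst n) a0) _.
rewrite lee_fin ler_pdivrMr ?exprn_gt0// -(natr1 n).
have : 8 * n%:R <= n%:R * (eta ^+ 2 * e) * n%:R.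
  by rewrite ler_pM2r// -ler_pdivrMr// mulr_gt0// exprn_gt0.
have -> : n%:R * (eta ^+ 2 * e) * n%:R = 4 * (e * (eta * n%:R / 2) ^+ 2) by field.
by move: n1; lra.
Unshelve. all: by end_near. Qed.

(** By tightness the deviation is at most [K * Num.sqrt n] up to probability [e], and this is below
    [eta * n] once [n] exceeds [(K / eta) ^+ 2]. *)
Lemma fringe_concentrate (t : btree) (beta : R) :
  is_beta_hat B t beta ->
  forall eta e : R, 0 < eta -> 0 < e -> \forall n \near \oo,
  (P n [set w | eta * n%:R <= `|(nfringe t (compress (B n w)))%:R - n%:R * beta|]%R
    <= e%:E)%E.
Proof.
move=> [_ [sigma _ cvgN]] eta e eta0 e0.
pose X n T := ((nfringe t (compress T))%:R - n%:R * beta) / Num.sqrt n%:R.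
have mX n : measurable_fun setT (fun w => X n (B n w)).
  exact: (measurable_bst_fun (X n)).
have [K K0 tight] := tight_of_cvg_in_distribution mX cvgN e0.
near=> n; have n0 : 0 < n%:R :> R by near: n; exact: nbhs_infty_gtr.
have nK : (K / eta) ^+ 2 < n%:R by near: n; exact: nbhs_infty_gtr.
apply: (@le_trans _ _ (P n [set w | (K < `|X n (B n w)|)%R])); last by near: n.
apply: le_measure; rewrite ?inE.
- exact: (measurable_preimage_bst (B n)
    (fun T => eta * n%:R <= `|(nfringe t (compress T))%:R - n%:R * beta|)).
- exact: (measurable_preimage_bst (B n) (fun T => K < `|X n T|)).
move=> w /=; have sqrtn0 : 0 < Num.sqrt (n%:R : R) by rewrite sqrtr_gt0.
rewrite /X normrM normfV (gtr0_norm sqrtn0) ltr_pdivlMr//; apply: lt_le_trans.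
rewrite -[X in _ < eta * X](sqr_sqrtr (ltW n0)) expr2 mulrA ltr_pM2r//.
rewrite mulrC -ltr_pdivrMr// -(ger0_norm (_ : 0 <= K / eta)) ?divr_ge0 ?ltW//.
by rewrite -sqrtr_sqr ltr_sqrt.
Unshelve. all: by end_near. Qed.

Lemma cvg_in_probability_q_given (s : forall n, n.-tuple R) (t : btree) (beta : R) :
  (forall n, uniq (s n)) -> (forall n, is_random_bst (s n) (B n)) ->
  is_beta_hat B t beta ->
  cvg_in_probability P (fun n w => q_given R t (compress (B n w)))
    (3 * (nleaves t)%:R * beta).
Proof.
move=> s_uniq B_bst beta_hat e e0; apply/cvg_measure0P => e' e'0.
have b0 : 0 <= beta by case: beta_hat => /ltW.
pose l : R := (nleaves t)%:R; have l0 : 0 <= l by [].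
(* The constant of [ratio_dev] times [l], with [l + 1] for [l] to make [M] positive and the final
   bound strict. *)
pose M := 6 * (l + 1) * (1 + 3 * beta).
have l1 : 0 < l + 1 by rewrite ltr_wpDl.
have b1 : 0 < 1 + 3 * beta by rewrite ltr_wpDr// mulr_ge0.
have M0 : 0 < M by rewrite !mulr_gt0.
pose eta := Num.min 6^-1 (e / M).
have eta0 : 0 < eta by rewrite lt_min invr_gt0 divr_gt0// ltr0n.
have e2 : 0 < e' / 2 by rewrite divr_gt0.
pose EN n : set (Om n) :=
  [set w | eta * n%:R <= `|(nfringe t (compress (B n w)))%:R - n%:R * beta|].
pose EL n : set (Om n) :=
  [set w | eta * n%:R <= `|(nleaves (B n w))%:R - n%:R / 3|].
have PN : \forall n \near \oo, (P n (EN n) <= (e' / 2)%:E)%E.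
  exact: fringe_concentrate.
have PL : \forall n \near \oo, (P n (EL n) <= (e' / 2)%:E)%E.
  exact: leaves_concentrate s_uniq B_bst _ _ eta0 e2.
have mN n : measurable (EN n) by exact: (measurable_preimage_bst (B n)
    (fun T => eta * n%:R <= `|(nfringe t (compress T))%:R - n%:R * beta|)).
have mL n : measurable (EL n) by exact: (measurable_preimage_bst (B n)
    (fun T => eta * n%:R <= `|(nleaves T)%:R - n%:R / 3|)).
near=> n; have n0 : 0 < n%:R :> R by near: n; exact: nbhs_infty_gtr.
apply: (@le_trans _ _ (P n (EN n `|` EL n))); last first.
  apply: le_trans (measureU2 _ (mN n) (mL n)) _.
  by rewrite (splitr e') EFinD; apply: leeD; near: n.
apply: le_measure; rewrite ?inE; [|exact: measurableU|].
  exact: (measurable_preimage_bst (B n)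
    (fun T => e <= `|q_given R t (compress T) - 3 * (nleaves t)%:R * beta|)).
(* By contraposition: outside [EN n] and [EL n] both counts are close to their centres, and
   [ratio_dev] applies. *)
move=> w /=; apply: contraPP => /not_orP[/negP + /negP].
rewrite -!ltNge => dN dL; apply/negP; rewrite -ltNge.
rewrite q_given_compress natrM -/l.
have -> : l * (nfringe t (compress (B n w)))%:R / (nleaves (B n w))%:R - 3 * l * beta
  = l * ((nfringe t (compress (B n w)))%:R / (nleaves (B n w))%:R - 3 * beta) by ring.
rewrite normrM (ger0_norm l0).
have eta6 : eta <= 6^-1 by rewrite ge_min lexx.
apply: le_lt_trans (ler_wpM2l l0 (ratio_dev n0 b0 eta6 dN dL)) _.
have : eta * M <= e by rewrite -ler_pdivlMr// ge_min lexx orbT.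
apply: lt_le_trans; rewrite /M -subr_gt0.
have -> : eta * (6 * (l + 1) * (1 + 3 * beta)) - l * (6 * eta * (1 + 3 * beta)) =
  6 * eta * (1 + 3 * beta) by ring.
by rewrite !mulr_gt0.
Unshelve. all: by end_near. Qed.

End random_bst_sequence.

Theorem corollary5p3 (R : realType)
    (s : forall n : nat, n.-tuple R) (s_uniq : forall n : nat, uniq (s n))
    (d : nat -> measure_display) (Om : forall n : nat, measurableType (d n))
    (P : forall n : nat, probability (Om n) R)
    (B : forall n : nat, {RV P n >-> btree})
    (B_bst : forall n : nat, is_random_bst (s n) (B n))
    (t : btree) (t_full : full t)
    (beta : R) (beta_hat : is_beta_hat B t beta) :
  let q := fun n : nat => q_random t (P n) (fun w => compress (B n w)) in
  let qoo := limn q in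
  [/\ cvg_in_probability P (fun n w => q_given R t (compress (B n w))) qoo,
      qoo = 3 * (nleaves t)%:R * beta
    & q @ \oo --> qoo].
Proof.
move=> q qoo; have qP := cvg_in_probability_q_given s_uniq B_bst beta_hat.
(* Convergence to the explicit constant comes first; uniqueness of limits then identifies [qoo],
   which is defined through [limn]. *)
have qE : q @ \oo --> 3 * (nleaves t)%:R * beta.
  apply: cvg_expectation_of_cvg_in_probability qP.
  - by rewrite !mulr_ge0//; case: beta_hat => /ltW.
  - move=> n.
    exact: (@measurable_bst_fun _ _ _ P B (fun T => q_given R t (compress T)) n).
  - by move=> n w; rewrite q_given_ge0 q_given_le1.
have -> : qoo = 3 * (nleaves t)%:R * beta by exact: cvg_lim qE.
by [].
Qed.
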